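(* The function $\bar H_\delta(\cdot):P\to\mathbb{R}$ has the following properties. 1. Let $c\in P$, $A\in\mathbb{R}$ and consider the problem of finding $v:\tilde{\mathcal{G}}_\delta|_{k\ge0}\to\mathbb{R}$, $1$-periodic in each space coordinate, with $v(\cdot,0)=v^0\in X_\delta$ and $(D_tv)^{k+1}_m+H(x_m,t_k,c+(D_xv)^k_m)=A$. This problem admits a time-$1$-periodic solution (i.e. $v^{k+2K}=v^k$ for all $k\ge0$) if and only if $A=\bar H_\delta(c)$ and $v^0$ satisfies $\varphi_\delta(v^0;c)+\bar H_\delta(c)=v^0$. 2. If $\bar v$ is a time-$1$-periodic solution of the problem in item 1 with $A=\bar H_\delta(c)$, then $$\bar H_\delta(c)=\sum_{\{(m,k)\,:\,(x_m,t_k)\in{\rm pr.}\,\mathcal{G}_\delta\}}H(x_m,t_k,c+(D_x\bar v)^k_m)\,2h^d\tau .$$ 3. Let $v$ be the solution of $(D_tv)^{k+1}_m+H(x_m,t_k,c+(D_xv)^k_m)=0$, $k\ge 0$, with arbitrary initial datum $v^0\in X_\delta$. Then $\lim_{l\to\infty}\frac{v^{l+1}_n}{t_{l+1}}=-\bar H_\delta(c)$ for any $n$ (the limit being along those $l$ with $(x_n,t_{l+1})\in\tilde{\mathcal{G}}_\delta$). 4. $\bar H_\delta(\cdot):P\to\mathbb{R}$ is convex (hence, Lipschitz continuous).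
   Context: Lagrangian: $\mathbb{T}=\mathbb{R}/\mathbb{Z}$, $\mathbb{T}^d=\mathbb{R}^d/\mathbb{Z}^d$; functions on tori are identified with $1$-periodic functions. $|x|_\infty=\max_j|x^j|$, $|\cdot|$ is the Euclidean norm. $L=L(x,t,\zeta):\mathbb{T}^d\times\mathbb{T}\times\mathbb{R}^d\to\mathbb{R}$ is $C^2$; $L_{\zeta\zeta}$ is positive definite everywhere; for each $a\ge0$ there is $b_1(a)\in\mathbb{R}$ with $L\ge a|\zeta|+b_1(a)$ everywhere; there is $\alpha>0$ with $|L_{x^j}|\le\alpha(1+|L|)$ everywhere ($j=1,\dots,d$). $H(x,t,p)=\sup_{\zeta\in\mathbb{R}^d}(p\cdot\zeta-L(x,t,\zeta))$, $L^{(c)}(x,t,\zeta)=L(x,t,\zeta)-c\cdot\zeta$. $P\subset\mathbb{R}^d$ is a fixed compact convex set and $r>0$ is a fixed number. Grid: $\delta=(h,\tau)$, $h=(2N)^{-1}$, $\tau=(2K)^{-1}$ with $N,K\in\mathbb{N}$, $\lambda=\tau/h$; $x_m=hm$ ($m\in\mathbb{Z}^d$), $t_k=\tau k$ ($k\in\mathbb{Z}$). $G_{\rm even}$ (resp. $G_{\rm odd}$) is the set of $x_m$ with $m^1+\dots+m^d$ even (resp. odd). $\mathcal{G}_\delta=\bigcup_{k}\{(G_{\rm even}\times\{t_{2k}\})\cup(G_{\rm odd}\times\{t_{2k+1}\})\}$, $\tilde{\mathcal{G}}_\delta=\bigcup_{k}\{(G_{\rm odd}\times\{t_{2k}\})\cup(G_{\rm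 even}\times\{t_{2k+1}\})\}$; ${\rm pr.}\,\mathcal{G}_\delta$ is the set of $(x_m,t_k)\in\mathcal{G}_\delta$ with $0\le m^i\le 2N-1$, $0\le k\le 2K-1$. $e_1,\dots,e_d$ is the standard basis, $B=\{\pm e_1,\dots,\pm e_d\}$. For $v:\tilde{\mathcal{G}}_\delta\to\mathbb{R}$ write $v^k_m=v(x_m,t_k)$ and, for $(x_m,t_k)\in\mathcal{G}_\delta$, $(D_{x^j}v)^k_m=\frac{v^k_{m+e_j}-v^k_{m-e_j}}{2h}$, $D_xv=(D_{x^1}v,\dots,D_{x^d}v)$, $(D_tv)^{k+1}_m=\frac1\tau\big(v^{k+1}_m-\frac1{2d}\sum_{\omega\in B}v^k_{m+\omega}\big)$. Solution map: $X_\delta$ is the set of functions $w:G_{\rm odd}\to\mathbb{R}$ that are $1$-periodic in each coordinate and satisfy $|D_xw|_\infty\le r$ on $G_{\rm even}$. For $v^0\in X_\delta$ and $c\in P$, $\varphi^k_\delta(v^0;c)=v(\cdot,t_k)$, $k\ge 0$, where $v$ solves the explicit recursion $(D_tv)^{k+1}_m+H(x_m,t_k,c+(D_xv)^k_m)=0$, $v(\cdot,0)=v^0$; $\varphi_\delta(\cdot;c):=\varphi^{2K}_\delta(\cdot;c)$. For $c\in P$, $\bar H_\delta(c)$ is the unique real number for which there is $\bar v^0\in X_\delta$ with $\varphi_\delta(\bar v^0;c)+\bar H_\delta(c)=\bar v^0$. Standing assumption: $r$ is taken large enough and $\delta$ small enough, with $\lambda<\lambda_1$ for a constant $\lambda_1=\lambda_1(r,P)>0$,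 so that for every $c\in P$ and $v^0\in X_\delta$: $\varphi_\delta(\cdot;c)$ maps $X_\delta$ into itself; $|H_p(x_m,t_k,c+(D_xv)^k_m)|_\infty\le(d\lambda_1)^{-1}<(d\lambda)^{-1}$ for all $k\ge0$ and $m$; and $v$ has the stochastic representation $v^{l+1}_n=\inf_\xi E\big[\sum_{0<k\le l+1}L^{(c)}(\gamma^k,t_{k-1},\xi^k_{m(\gamma^k)})\tau+v^0_{m(\gamma^0)}\big]$, where $m(x)$ is the index of a grid point $x$, the infimum is over controls $\xi$ on $\tilde{\mathcal{G}}_\delta$ with values in $[-(d\lambda)^{-1},(d\lambda)^{-1}]^d$, $\gamma$ is the backward random walk with $\gamma^{l+1}=x_n$ jumping from $(x_m,t_{k+1})$ to $(x_m+h\omega,t_k)$ with probability $\frac1{2d}-\frac\lambda2\omega\cdot\xi^{k+1}_m$ ($\omega\in B$), and the minimizing control is $\xi^{*\,k+1}_m=H_p(x_m,t_k,c+(D_xv)^k_m)$. *)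

(* Defs.v *)
From HB Require Import structures.
From mathcomp Require Import all_boot all_order all_algebra.
From mathcomp Require Import all_classical all_reals all_analysis.

Set Implicit Arguments.
Unset Strict Implicit.
Unset Printing Implicit Defensive.

Import Order.TTheory GRing.Theory Num.Theory.
Import numFieldNormedType.Exports.

Local Open Scope classical_set_scope.
Local Open Scope ring_scope.

Section Calculus.
Context {R : realType}.

Definition dotp {d : nat} (u v : 'rV[R]_d) : R := \sum_j u 0 j * v 0 j.

(* Euclidean norm; the library norm `|u| on 'rV[R]_d is the maximum norm *)
Definition enorm {d : nat} (u : 'rV[R]_d) : R := Num.sqrt (dotp u u).

Definition partial {d : nat} (j : 'I_d) (f : 'rV[R]_d -> R^o) (x : 'rV[R]_d) :
  R := 'D_(delta_mx 0 j) f x.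

Definition grad {d : nat} (f : 'rV[R]_d -> R^o) (x : 'rV[R]_d) : 'rV[R]_d :=
  \row_j partial j f x.

Definition hessian {d : nat} (f : 'rV[R]_d -> R^o) (x : 'rV[R]_d) : 'M[R]_d :=
  \matrix_(i, j) partial i (partial j f) x.

Definition posdefmx {d : nat} (A : 'M[R]_d) : Prop :=
  A^T = A /\ forall u : 'rV[R]_d, u != 0 -> 0 < (u *m A *m u^T) 0 0.

(* On a finite-dimensional V, continuity of x |-> 'D_v f x for each v is
   continuity of x |-> 'd f x. *)
Definition C1 {V : normedModType R} (f : V -> R^o) : Prop :=
  (forall x, differentiable f x) /\ (forall v, continuous ('D_v f)).

Definition C2 {V : normedModType R} (f : V -> R^o) : Prop :=
  C1 f /\ (forall v, C1 ('D_v f)).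

End Calculus.

Section Lagrangian.
Context {R : realType} {d : nat}.
Variable L : 'rV[R]_d -> R -> 'rV[R]_d -> R.

Record lagrangian : Prop := Lagrangian {
  lagr_periodic_x : forall (j : 'I_d) x t zeta,
    L (x + delta_mx 0 j) t zeta = L x t zeta;
  lagr_periodic_t : forall x t zeta, L x (t + 1) zeta = L x t zeta;
  lagr_C2 : C2 (fun y : 'rV[R]_d * R^o * 'rV[R]_d => L y.1.1 y.1.2 y.2);
  lagr_posdef : forall x t zeta, posdefmx (hessian (L x t) zeta);
  lagr_superlinear : forall a : R, 0 <= a -> exists b1 : R,
    forall x t zeta, a * enorm zeta + b1 <= L x t zeta;
  lagr_growth_x : exists2 alpha : R, 0 < alpha & forall (j : 'I_d) x t zeta,
    `|partial j (fun y => L y t zeta) x| <= alpha * (1 + `|L x t zeta|) }.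

Definition hamiltonian (x : 'rV[R]_d) (t : R) (p : 'rV[R]_d) : R :=
  sup [set dotp p zeta - L x t zeta | zeta in [set: 'rV[R]_d]].

Definition hamiltonian_p (x : 'rV[R]_d) (t : R) (p : 'rV[R]_d) : 'rV[R]_d :=
  grad (hamiltonian x t) p.

Definition lagrangian_c (c x : 'rV[R]_d) (t : R) (zeta : 'rV[R]_d) : R :=
  L x t zeta - dotp c zeta.

End Lagrangian.

(* Grid points are handled through their indices: m : 'rV[int]_d stands for
   x_m = hm and k : nat for t_k = tau k (only k >= 0 is ever used).  A function
   on a staggered grid is a total function of (k, m), only its values at the
   points of the grid being relevant; accordingly every equation or bound
   between grid functions below is restricted to the grid. *)
Section Grid.
Context {d : nat}.

Definition Geven (m : 'rV[int]_d) : bool := ~~ odd `|(\sum_j m 0 j)%R|%N.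
Definition Godd (m : 'rV[int]_d) : bool := odd `|(\sum_j m 0 j)%R|%N.

Definition grid (k : nat) (m : 'rV[int]_d) : bool :=
  if odd k then Godd m else Geven m.
Definition dual_grid (k : nat) (m : 'rV[int]_d) : bool :=
  if odd k then Geven m else Godd m.

Definition unit_idx (j : 'I_d) : 'rV[int]_d := delta_mx 0 j.

(* the set B = {+-e_1, ..., +-e_d} *)
Definition dir : finType := (bool * 'I_d)%type.
Definition dir_idx (w : dir) : 'rV[int]_d :=
  if w.1 then unit_idx w.2 else - unit_idx w.2.

Definition box_idx {n : nat} (m : 'rV['I_n]_d) : 'rV[int]_d :=
  \row_j (nat_of_ord (m 0 j))%:Z.

End Grid.

Section Scheme.
Context {R : realType} {d : nat}.
Variable L : 'rV[R]_d -> R -> 'rV[R]_d -> R.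
Variables N K : nat.

Notation idx := 'rV[int]_d.
Notation H := (hamiltonian L).
Notation H_p := (hamiltonian_p L).

Definition mesh_h : R := (2 * N)%:R^-1.
Definition mesh_tau : R := (2 * K)%:R^-1.
Definition mesh_lambda : R := mesh_tau / mesh_h.
Definition pos (m : idx) : 'rV[R]_d := \row_j (mesh_h * (m 0 j)%:~R).
Definition time (k : nat) : R := mesh_tau * k%:R.

Definition Dx (w : idx -> R) (m : idx) : 'rV[R]_d :=
  \row_j ((w (m + unit_idx j) - w (m - unit_idx j)) / (2 * mesh_h)).

Definition average (w : idx -> R) (m : idx) : R :=
  (2 * d)%:R^-1 * \sum_(o : dir) w (m + dir_idx o).

(* (D_t v)^{k+1}_m *)
Definition Dt (v : nat -> idx -> R) (k : nat) (m : idx) : R :=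
  (v k.+1 m - average (v k) m) / mesh_tau.

(* 1-periodicity, i.e. invariance under shifts of an index by 1/h = 2N *)
Definition periodic_on (G : idx -> bool) (w : idx -> R) : Prop :=
  forall (j : 'I_d) m, G m -> w (m + unit_idx j *+ (2 * N)) = w m.

Definition Xdelta (r : R) (w : idx -> R) : Prop :=
  periodic_on Godd w /\ forall m, Geven m -> `|Dx w m| <= r.

Definition solves (c : 'rV[R]_d) (A : R) (v : nat -> idx -> R) : Prop :=
  forall k m, grid k m ->
    Dt v k m + H (pos m) (time k) (c + Dx (v k) m) = A.

Definition starts_from (v0 : idx -> R) (v : nat -> idx -> R) : Prop :=
  forall m, Godd m -> v 0%N m = v0 m.

Definition solution (r : R) (c : 'rV[R]_d) (A : R) (v0 : idx -> R)
    (v : nat -> idx -> R) : Prop :=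
  [/\ forall k, periodic_on (dual_grid k) (v k), Xdelta r v0,
      starts_from v0 v & solves c A v].

Definition time_periodic (v : nat -> idx -> R) : Prop :=
  forall k m, dual_grid k m -> v (k + 2 * K)%N m = v k m.

(* The recursion D_t v + H = 0 solved for v^{k+1}_m.  Both parities of m are
   propagated, but they do not interact. *)
Fixpoint phi_step (c : 'rV[R]_d) (v0 : idx -> R) (k : nat) : idx -> R :=
  if k is k'.+1 then
    fun m => average (phi_step c v0 k') m
      - mesh_tau * H (pos m) (time k') (c + Dx (phi_step c v0 k') m)
  else v0.

Definition phi (c : 'rV[R]_d) (v0 : idx -> R) : idx -> R :=
  phi_step c v0 (2 * K).

(* phi(v0; c) + A = v0 as functions on G_odd *)
Definition stationary (c : 'rV[R]_d) (A : R) (v0 : idx -> R) : Prop :=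
  forall m, Godd m -> phi c v0 m + A = v0 m.

Definition is_effective_hamiltonian (r : R) (c : 'rV[R]_d) (A : R) : Prop :=
  unique (fun B : R => exists2 v0, Xdelta r v0 & stationary c B v0) A.

(* Backward random walk on a finite path space: a path from index n at time
   t_{l+1} down to time 0 is the family of its l+1 jumps, s k being the jump
   from t_{k+1} to t_k. *)
Section RandomWalk.
Variables (l : nat) (n : idx) (xi : nat -> idx -> 'rV[R]_d).

Definition walk (s : {ffun 'I_l.+1 -> @dir d}) (k : nat) : idx :=
  n + \sum_(i < l.+1 | (k <= i)%N) dir_idx (s i).

Definition jump_proba (k : nat) (m : idx) (o : dir) : R :=
  (2 * d)%:R^-1
  - mesh_lambda / 2 * dotp (map_mx intr (dir_idx o)) (xi k.+1 m).

Definition walk_proba (s : {ffun 'I_l.+1 -> dir}) : R :=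
  \prod_(k < l.+1) jump_proba k (walk s k.+1) (s k).

Definition expected_cost (c : 'rV[R]_d) (v0 : idx -> R) : R :=
  \sum_(s : {ffun 'I_l.+1 -> dir}) walk_proba s *
    (\sum_(k < l.+1)
       lagrangian_c L c (pos (walk s k.+1)) (time k)
         (xi k.+1 (walk s k.+1)) * mesh_tau
     + v0 (walk s 0)).

End RandomWalk.

Definition admissible (xi : nat -> idx -> 'rV[R]_d) : Prop :=
  forall k m, (0 < k)%N -> dual_grid k m ->
    `|xi k m| <= (d%:R * mesh_lambda)^-1.

Definition optimal_control (c : 'rV[R]_d) (v0 : idx -> R) (k : nat) (m : idx) :
    'rV[R]_d :=
  if k is k'.+1 then
    H_p (pos m) (time k') (c + Dx (phi_step c v0 k') m)
  else 0.

Record standing_assumption (P : set 'rV[R]_d) (r lambda1 : R) : Prop :=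
  StandingAssumption {
  sa_lambda1_gt0 : 0 < lambda1;
  sa_lambda_lt : mesh_lambda < lambda1;
  sa_invariant : forall c v0, P c -> Xdelta r v0 -> Xdelta r (phi c v0);
  sa_CFL : forall c v0, P c -> Xdelta r v0 -> forall k m, grid k m ->
    `|H_p (pos m) (time k) (c + Dx (phi_step c v0 k) m)|
      <= (d%:R * lambda1)^-1;
  sa_representation : forall c v0, P c -> Xdelta r v0 ->
    forall l n, dual_grid l.+1 n ->
    phi_step c v0 l.+1 n =
      inf [set expected_cost l n xi c v0 | xi in admissible];
  sa_minimizer : forall c v0, P c -> Xdelta r v0 ->
    admissible (optimal_control c v0) /\
    forall l n, dual_grid l.+1 n ->
    phi_step c v0 l.+1 n = expected_cost l n (optimal_control c v0) c v0 }.

End Scheme.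

(* Main.v *)
Require Import Defs.
From HB Require Import structures.
From mathcomp Require Import all_boot all_order all_algebra.
From mathcomp Require Import all_classical all_reals all_analysis.
From mathcomp Require Import ring lra.

Set Implicit Arguments.
Unset Strict Implicit.
Unset Printing Implicit Defensive.

Import Order.TTheory GRing.Theory Num.Theory.
Import numFieldNormedType.Exports.

Local Open Scope classical_set_scope.
Local Open Scope ring_scope.

(** Two features of the solution map of the scheme carry the whole proof: it
    commutes with the addition of constants, and it is order preserving.

    Adding [A * time K k] to a solution leaves its space differences unchanged
    and adds [A] to its time difference.  Hence the solutions with right-hand
    side [A] are exactly the functions [phi_step + A * time]
    ([solves_phi_step], [solves_phi_step_addt]).  As [H] has period 1 in time,
    such a function is periodic in time as soon as it takes the same values at
    the times 0 and 1, which says that its datum is stationary at level [A]; the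
    uniqueness of the level then forces [A = Hbar c].  The formula for [Hbar c]
    as a mean of [H] comes from summing the equation over a space-time period:
    averaging over the neighbours preserves the sum over a space period, so the
    time differences telescope to zero ([mean_hamiltonian]).

    Order preservation is read off from the stochastic representation.  The
    value is at most the expected cost of any admissible control
    ([phi_step_le_expected_cost]), and this applies in particular to the control
    that is optimal for another datum and another parameter.  Since the cost is
    affine in [c] and in the datum, this gives the comparison principle
    [phi_step_compare].  A datum that is stationary at level [A] decreases by
    exactly [A] over each period; by comparison, at each node every solution stays
    within a bounded distance of [- A * time] ([phi_step_growth]).  This is the time
    average statement.  It also identifies [- Hbar c] with the growth rate of an
    infimum of costs that are affine in [c], hence concave in [c], which makes
    [Hbar] convex ([stationary_level_convex]).  Finally, the controls are bounded
    by [(d * lambda)^-1], so the cost per unit of time is Lipschitz in [c],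
    uniformly in the control, and so is its growth rate
    ([stationary_level_lipschitz]). *)

(** * Parity of grid indices *)

Lemma odd_abszD (a b : int) : odd `|(a + b)%R|%N = odd `|a|%N (+) odd `|b|%N.
Proof.
have oddN1 (x : int) : (-1) ^ x = (-1) ^+ odd `|x|%N :> int.
  by rewrite signr_odd; case: x => n //=; rewrite invr_sign.
have := oddN1 (a + b); rewrite exprzDr ?unitrN1 // !oddN1.
by case: (odd `|a|%N); case: (odd `|b|%N); case: (odd _).
Qed.

Section Parity.
Context {d : nat}.
Implicit Types (m p : 'rV[int]_d) (j : 'I_d) (o : @dir d).

Lemma GoddD m p : Godd (m + p) = Godd m (+) Godd p.
Proof.
rewrite /Godd -odd_abszD -big_split /=.
by under eq_bigr do rewrite mxE.
Qed.

Lemma Godd0 : Godd (0 : 'rV[int]_d) = false.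
Proof. by rewrite /Godd big1 // => j _; rewrite mxE. Qed.

Lemma Godd_unit_idx j : Godd (unit_idx j).
Proof.
rewrite /Godd (bigD1 j) //= big1 => [|i /negPf ij]; rewrite !mxE ?eqxx //.
by rewrite ij.
Qed.

Lemma Godd_dir_idx o : Godd (dir_idx o).
Proof.
case: o => -[] j; rewrite /dir_idx /=; first exact: Godd_unit_idx.
have := Godd0; rewrite -(subrr (unit_idx j)) GoddD Godd_unit_idx.
by case: (Godd _).
Qed.

Lemma Godd_mulr2n m n : Godd (m *+ (2 * n)) = false.
Proof.
rewrite mulrnA; elim: n => [|n IHn]; first by rewrite mulr0n Godd0.
by rewrite mulrSr GoddD IHn mulr2n GoddD addbb.
Qed.

Lemma dual_gridE k m : dual_grid k m = odd k (+) Godd m.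
Proof. by rewrite /dual_grid /Geven; case: (odd k). Qed.

Lemma gridE k m : grid k m = dual_grid k.+1 m.
Proof. by rewrite dual_gridE /grid /Geven /=; case: (odd k). Qed.

Lemma dual_gridS k m o : dual_grid k (m + dir_idx o) = dual_grid k.+1 m.
Proof.
by rewrite !dual_gridE GoddD Godd_dir_idx /=; case: (odd k); case: (Godd m).
Qed.

Lemma dual_grid_shift k m j n :
  dual_grid k (m + unit_idx j *+ (2 * n)) = dual_grid k m.
Proof. by rewrite !dual_gridE GoddD Godd_mulr2n addbF. Qed.

Lemma dual_grid_period k K m : dual_grid (k + 2 * K) m = dual_grid k m.
Proof. by rewrite !dual_gridE oddD mul2n odd_double addbF. Qed.

End Parity.

(** * Periodic functions on the index lattice *)

Section Periodicity.
Context {R : realType} {d : nat}.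
Context (N : nat) (N_gt0 : (0 < N)%N).
Implicit Types (F w : 'rV[int]_d -> R).

(** The extension by zero from a staggered grid turns periodicity on the grid
    into periodicity on the whole lattice, where sums can be shifted freely. *)
Definition restrict_grid (k : nat) w (m : 'rV[int]_d) : R :=
  if dual_grid k m then w m else 0.

Lemma periodic_restrict_grid k w :
  periodic_on N (dual_grid k) w -> periodic_on N xpredT (restrict_grid k w).
Proof.
move=> wP j m _; rewrite /restrict_grid dual_grid_shift.
by case: ifP => // /wP ->.
Qed.

(** The periods of a function form a subgroup, so the [d] generating periods
    yield the whole lattice of periods. *)
Lemma periodic_on_lattice F (q : 'rV[int]_d) m :
  periodic_on N xpredT F -> F (m + q *+ (2 * N)) = F m.
Proof.
move=> FP; pose T := [set p | forall m', F (m' + p) = F m'].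
have T0 : T 0 by move=> m'; rewrite addr0.
have TD p p' : T p -> T p' -> T (p + p') by move=> Tp Tp' m'; rewrite addrA Tp'.
have TN p : T p -> T (- p) by move=> Tp m'; rewrite -{2}(subrK p m') Tp.
suff : T (q *+ (2 * N)) by exact.
rewrite [q]row_sum_delta -sumrMnl; elim/big_ind: _ => // j _.
rewrite scalerMnr.
have Tj : T (delta_mx 0 j *+ (2 * N)) by move=> m'; exact: FP.
have TM n : T ((delta_mx 0 j *+ (2 * N)) *+ n).
  by elim: n => [|n IHn]; rewrite ?mulr0n // mulrSr; exact: TD.
case: (q 0 j) => n; first by rewrite -natz scaler_nat.
by rewrite NegzE scaleNr -natz scaler_nat; exact/TN/TM.
Qed.

Lemma periodic_bounded F :
  periodic_on N xpredT F -> exists B : R, forall m, `|F m| <= B.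
Proof.
move=> FP; exists (\sum_(m : 'rV['I_(2 * N)]_d) `|F (box_idx m)|) => m.
have n_gt0 : (0 < 2 * N)%N by rewrite muln_gt0.
have modlt a : (`|(a %% (2 * N)%N)%Z|%N < 2 * N)%N.
  by rewrite -ltz_nat gez0_abs ?modz_ge0 ?ltz_pmod // -lt0n.
(* Every index has a representative with entries in [0, 2N). *)
pose b : 'rV['I_(2 * N)]_d := \row_j Ordinal (modlt (m 0 j)).
have -> : F m = F (box_idx b).
  pose q : 'rV[int]_d := \row_j divz (m 0 j) (2 * N)%N.
  rewrite -(periodic_on_lattice q (box_idx b) FP); congr F.
  apply/rowP => j; rewrite mxE mulmxnE !mxE /=.
  rewrite gez0_abs ?modz_ge0 -?lt0n // addrC -mulr_natr natz.
  exact: divz_eq.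
by rewrite (bigD1 b) //= lerDl sumr_ge0.
Qed.

Lemma sum_box_unit_idx F (j : 'I_d) : periodic_on N xpredT F ->
  \sum_(m : 'rV['I_(2 * N)]_d) F (box_idx m + unit_idx j) =
  \sum_(m : 'rV['I_(2 * N)]_d) F (box_idx m).
Proof.
move=> FP.
pose s (m : 'rV['I_(2 * N)]_d) := \row_i if i == j then ordS (m 0 i) else m 0 i.
have s_inj : injective s.
  move=> m m' /rowP E; apply/rowP => i; have := E i; rewrite !mxE.
  by case: eqP => // _ /ordS_inj.
rewrite [RHS](reindex_inj s_inj); apply: eq_bigr => m _.
have [lt_m|ge_m] := ltnP (m 0 j).+1 (2 * N).
  congr F; apply/rowP => i; rewrite !mxE eqxx /=.
  case: (eqVneq i j) => [->|] /=; last by rewrite addr0.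
  by rewrite modn_small // intS addrC.
(* At the end of the box, the cyclic successor differs from the shift by one
   full period. *)
rewrite -[RHS](FP j) //; congr F; apply/rowP => i.
rewrite [RHS]mxE mulmxnE !mxE eqxx /=.
case: (eqVneq i j) => [->|] /=; last by rewrite mul0rn !addr0.
have mj : (m 0 j).+1 = (2 * N)%N by apply/eqP; rewrite eqn_leq ge_m ltn_ord.
have mjz : (m 0 j)%:Z + 1 = (2 * N)%:Z by rewrite addrC -intS mj.
by rewrite {1}mj modnn add0r mjz; exact/esym/natz.
Qed.

Lemma sum_box_dir_idx F (o : @dir d) : periodic_on N xpredT F ->
  \sum_(m : 'rV['I_(2 * N)]_d) F (box_idx m + dir_idx o) =
  \sum_(m : 'rV['I_(2 * N)]_d) F (box_idx m).
Proof.
case: o => -[] j FP; rewrite /dir_idx /=; first exact: sum_box_unit_idx.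
rewrite -(@sum_box_unit_idx (fun m => F (m - unit_idx j)) j).
  by apply: eq_bigr => m _; rewrite addrK.
by move=> i m _; rewrite addrAC FP.
Qed.

End Periodicity.

(** * The recursion and its symmetries *)

Section Scheme.
Context {R : realType} {d : nat} (d_gt0 : (0 < d)%N).
Context (L : 'rV[R]_d -> R -> 'rV[R]_d -> R) (hL : lagrangian L).
Context (N K : nat) (N_gt0 : (0 < N)%N) (K_gt0 : (0 < K)%N).
Implicit Types (c : 'rV[R]_d) (m : 'rV[int]_d) (u w : 'rV[int]_d -> R)
  (v : nat -> 'rV[int]_d -> R) (A B a : R).

Lemma mesh_tau_gt0 : 0 < mesh_tau K :> R.
Proof. by rewrite invr_gt0 ltr0n muln_gt0. Qed.

Lemma mesh_h_gt0 : 0 < mesh_h N :> R.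
Proof. by rewrite invr_gt0 ltr0n muln_gt0. Qed.

Lemma mesh_lambda_gt0 : 0 < mesh_lambda N K :> R.
Proof. exact: divr_gt0 mesh_tau_gt0 mesh_h_gt0. Qed.

Lemma timeS k : time K k.+1 = time K k + mesh_tau K :> R.
Proof. by rewrite /time -addn1 natrD mulrDr mulr1. Qed.

Lemma timeD k l : time K (k + l) = time K k + time K l :> R.
Proof. by rewrite /time natrD mulrDr. Qed.

Lemma time_periods j : time K (j * (2 * K)) = j%:R :> R.
Proof.
by rewrite /time natrM mulrCA mulVf ?mulr1 // pnatr_eq0 -lt0n muln_gt0 K_gt0.
Qed.

Lemma time_period : time K (2 * K) = 1 :> R.
Proof. by have := time_periods 1; rewrite mul1n. Qed.

Lemma hamiltonian_shift_x m j k p :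
  hamiltonian L (pos N (m + unit_idx j *+ (2 * N))) (time K k) p =
  hamiltonian L (pos N m) (time K k) p.
Proof.
have -> : pos N (m + unit_idx j *+ (2 * N)) = pos N m + delta_mx 0 j :> 'rV[R]_d.
  apply/rowP => i; rewrite mxE [in LHS]mxE mulmxnE !mxE intrD mulrDr; congr (_ + _).
  rewrite eqxx /= rmorphMn /= -mulr_natr mulrCA mulVf ?mulr1.
    by case: (i == j).
  by rewrite pnatr_eq0 -lt0n muln_gt0 N_gt0.
rewrite /hamiltonian; congr (sup (image _ _)); apply/funext => zeta.
by rewrite (lagr_periodic_x hL).
Qed.

Lemma hamiltonian_shift_t (x p : 'rV[R]_d) k :
  hamiltonian L x (time K (k + 2 * K)) p = hamiltonian L x (time K k) p.
Proof.
rewrite timeD time_period.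
rewrite /hamiltonian; congr (sup (image _ _)); apply/funext => zeta.
by rewrite (lagr_periodic_t hL).
Qed.

Lemma average_addcst w w' m m' a :
  (forall o, w' (m' + dir_idx o) = w (m + dir_idx o) + a) ->
  average w' m' = average w m + a.
Proof.
move=> E; rewrite /average (eq_bigr _ (fun o _ => E o)) big_split /= mulrDr.
congr (_ + _); rewrite sumr_const card_prod card_bool card_ord -[a *+ _]mulr_natr.
by rewrite mulrCA mulVf ?mulr1 // pnatr_eq0 -lt0n muln_gt0 d_gt0.
Qed.

Lemma Dx_addcst w w' m m' a :
  (forall o, w' (m' + dir_idx o) = w (m + dir_idx o) + a) ->
  Dx N w' m' = Dx N w m.
Proof.
move=> E; apply/rowP => j; rewrite !mxE.
by rewrite (E (true, j)) (E (false, j)) /dir_idx /= opprD addrACA subrr addr0.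
Qed.

(** One time step of all the comparisons between two solutions: translations by
    a period in space or in time, and a change of right-hand side, are all seen
    by the scheme as a constant added to the neighbouring values. *)
Lemma solves_propagate c A B v v' k k' m m' a :
  solves L N K c A v -> solves L N K c B v' ->
  dual_grid k.+1 m -> dual_grid k'.+1 m' ->
  (forall p, hamiltonian L (pos N m') (time K k') p =
             hamiltonian L (pos N m) (time K k) p) ->
  (forall o, v' k' (m' + dir_idx o) = v k (m + dir_idx o) + a) ->
  v' k'.+1 m' = v k.+1 m + (a + (B - A) * mesh_tau K).
Proof.
rewrite -!gridE => sv sv' km km' EH E.
have := sv _ _ km; have := sv' _ _ km'; rewrite /Dt (Dx_addcst E) EH.
rewrite (average_addcst E) => EB EA.
have t0 : mesh_tau K != 0 :> R by rewrite gt_eqF ?mesh_tau_gt0.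
have -> : B - A = (v' k'.+1 m' - (average (v k) m + a)) / mesh_tau K
                  - (v k.+1 m - average (v k) m) / mesh_tau K.
  by rewrite -EA -EB; ring.
by field.
Qed.

Lemma phi_step_solves c u0 : solves L N K c 0 (phi_step L N K c u0).
Proof.
move=> k m _ /=; rewrite /Dt /=.
have t0 : mesh_tau K != 0 :> R by rewrite gt_eqF ?mesh_tau_gt0.
by field.
Qed.

Lemma solves_phi_step c A u0 v k m : solves L N K c A v -> starts_from u0 v ->
  dual_grid k m -> v k m = phi_step L N K c u0 k m + A * time K k.
Proof.
move=> sv u0E; elim: k m => [|k IHk] m km.
  by rewrite /time mulr0 mulr0 addr0 u0E.
rewrite (solves_propagate (phi_step_solves c u0) sv km km _
  (a := A * time K k)) //; first by rewrite timeS subr0; ring.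
by move=> o; rewrite IHk // dual_gridS.
Qed.

Lemma solves_phi_step_addt c A u0 :
  solves L N K c A (fun k m => phi_step L N K c u0 k m + A * time K k).
Proof.
move=> k m km; rewrite /Dt.
rewrite (@average_addcst (phi_step L N K c u0 k) _ m m (A * time K k)) //.
rewrite (@Dx_addcst (phi_step L N K c u0 k) _ m m (A * time K k)) //.
have := phi_step_solves c u0 km; rewrite /Dt timeS => E.
have t0 : mesh_tau K != 0 :> R by rewrite gt_eqF ?mesh_tau_gt0.
by rewrite -[RHS]addr0 -E; field.
Qed.

Lemma phi_step_addcst c u0 a k m :
  phi_step L N K c (fun m => u0 m + a) k m = phi_step L N K c u0 k m + a.
Proof.
elim: k m => [//|k IHk] m /=.
rewrite (@average_addcst (phi_step L N K c u0 k) _ m m a) //.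
by rewrite (@Dx_addcst (phi_step L N K c u0 k) _ m m a) // addrAC.
Qed.

Lemma phi_step_periodic c u0 k : periodic_on N Godd u0 ->
  periodic_on N (dual_grid k) (phi_step L N K c u0 k).
Proof.
move=> u0P j; elim: k => [|k IHk] m km; first by rewrite /= u0P.
have km' : dual_grid k.+1 (m + unit_idx j *+ (2 * N)) by rewrite dual_grid_shift.
have S := @phi_step_solves c u0.
rewrite (solves_propagate S S km km' (a := 0)) ?subrr ?mul0r ?addr0 //.
  by move=> p; exact: hamiltonian_shift_x.
by move=> o; rewrite addrAC addr0 IHk // dual_gridS.
Qed.

Lemma phi_step_period c A u0 k m : stationary L N K c A u0 -> dual_grid k m ->
  phi_step L N K c u0 (k + 2 * K) m = phi_step L N K c u0 k m - A.
Proof.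
move=> st; elim: k m => [|k IHk] m km.
  by rewrite add0n /= -(st _ km) addrK.
have km' : dual_grid (k + 2 * K).+1 m by rewrite -addSn dual_grid_period.
have S := @phi_step_solves c u0.
rewrite addSn (solves_propagate S S km km' (a := - A)) ?subrr ?mul0r ?addr0 //.
  by move=> p; exact: hamiltonian_shift_t.
by move=> o; rewrite IHk // dual_gridS.
Qed.

Lemma phi_step_periods c A u0 j k m : stationary L N K c A u0 ->
  dual_grid k m ->
  phi_step L N K c u0 (k + j * (2 * K)) m =
  phi_step L N K c u0 k m - j%:R * A.
Proof.
move=> st; elim: j => [|j IHj] km; first by rewrite addn0 mul0r subr0.
have km' : dual_grid (k + j * (2 * K)) m by rewrite mulnCA dual_grid_period.
rewrite mulSn addnCA addnC (phi_step_period st km') IHj //.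
by rewrite -natr1; ring.
Qed.

Lemma time_periodic_phi_step c A u0 : stationary L N K c A u0 ->
  time_periodic K (fun k m => phi_step L N K c u0 k m + A * time K k).
Proof.
move=> st k m km; rewrite (phi_step_period st km) timeD.
by rewrite time_period; ring.
Qed.

Lemma time_periodic_stationary c A u0 v : solves L N K c A v ->
  starts_from u0 v -> time_periodic K v -> stationary L N K c A u0.
Proof.
move=> sv u0E vP m m_odd; rewrite -(u0E _ m_odd) -(vP 0%N _ m_odd) add0n.
have km : dual_grid (2 * K) m by rewrite -[(2 * K)%N]add0n dual_grid_period.
rewrite (solves_phi_step sv u0E km).
by rewrite time_period mulr1.
Qed.

(** * The mean of the Hamiltonian over a period *)

Section Mean.

Let box := 'rV['I_(2 * N)]_d.

Lemma sum_box_grid k w o : periodic_on N (dual_grid k) w ->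
  \sum_(m : box | grid k (box_idx m)) w (box_idx m + dir_idx o) =
  \sum_(m : box | dual_grid k (box_idx m)) w (box_idx m).
Proof.
move=> wP; rewrite big_mkcond [RHS]big_mkcond /=.
have := sum_box_dir_idx o (periodic_restrict_grid wP).
rewrite /restrict_grid => <-; apply: eq_bigr => m _.
by rewrite dual_gridS gridE.
Qed.

Lemma sum_box_average k w : periodic_on N (dual_grid k) w ->
  \sum_(m : box | grid k (box_idx m)) average w (box_idx m) =
  \sum_(m : box | dual_grid k (box_idx m)) w (box_idx m).
Proof.
move=> wP; rewrite /average -mulr_sumr exchange_big /=.
under eq_bigr do rewrite (sum_box_grid _ wP).
rewrite sumr_const card_prod card_bool card_ord -[X in _ * X]mulr_natl mulrA.
by rewrite mulVf ?mul1r // pnatr_eq0 -lt0n muln_gt0 d_gt0.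
Qed.

(** The two staggered grids are exchanged by the shift along a basis vector, so
    each of them occupies exactly half of the box. *)
Lemma card_box_grid k :
  2 * \sum_(m : box | grid k (box_idx m)) 1 = (2 * N)%:R ^+ d :> R.
Proof.
have P1 : periodic_on N (@dual_grid d k) (fun=> 1 : R) by [].
have E := sum_box_grid (true, Ordinal d_gt0) P1.
rewrite mulr_natl mulr2n {2}E.
have -> : \sum_(m : box | dual_grid k (box_idx m)) 1 =
          \sum_(m : box | ~~ grid k (box_idx m)) 1 :> R.
  by apply: eq_bigl => m; rewrite gridE !dual_gridE /= addNb negbK.
transitivity (\sum_(m : box) (1 : R)).
  by rewrite [RHS](bigID (fun m : box => grid k (box_idx m))).
by rewrite sumr_const card_mx card_ord mul1n natrX.
Qed.

Lemma mean_hamiltonian c A v :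
  (forall k, periodic_on N (dual_grid k) (v k)) ->
  solves L N K c A v -> time_periodic K v ->
  A = \sum_(k < 2 * K) \sum_(m : box | grid k (box_idx m))
        hamiltonian L (pos N (box_idx m)) (time K k)
          (c + Dx N (v k) (box_idx m)) * (2 * mesh_h N ^+ d * mesh_tau K).
Proof.
move=> vP sv vT.
(* [S k] is the total mass at time [k]; it returns to its initial value after
   one period. *)
pose S k := \sum_(m : box | dual_grid k (box_idx m)) v k (box_idx m).
pose C := \sum_(m : box | grid 0 (box_idx m)) (1 : R).
have t0 : mesh_tau K != 0 :> R by rewrite gt_eqF ?mesh_tau_gt0.
have card k : \sum_(m : box | grid k (box_idx m)) 1 = C.
  have := card_box_grid k; rewrite -(card_box_grid 0).
  by move/(mulfI (_ : 2 != 0)) => -> //; rewrite pnatr_eq0.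
have Ek k : \sum_(m : box | grid k (box_idx m))
    hamiltonian L (pos N (box_idx m)) (time K k)
      (c + Dx N (v k) (box_idx m)) = A * C - (S k.+1 - S k) / mesh_tau K.
  transitivity (\sum_(m : box | grid k (box_idx m))
    (A - (v k.+1 (box_idx m) - average (v k) (box_idx m)) / mesh_tau K)).
    by apply: eq_bigr => m km; rewrite -(sv _ _ km) /Dt addrAC subrr add0r.
  rewrite big_split /= sumrN -mulr_suml big_split /= sumrN.
  rewrite (sum_box_average (vP k)) -(card k) mulr_sumr mulr1.
  by congr (_ - (_ - _) / _); apply: eq_bigl => m; rewrite gridE.
under eq_bigr do rewrite -mulr_suml Ek.
rewrite -mulr_suml big_split /= sumr_const card_ord sumrN -mulr_suml.
rewrite -(big_mkord xpredT (fun k => S k.+1 - S k)) telescope_sumr //.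
have -> : S (2 * K)%N = S 0%N.
  rewrite /S -[(2 * K)%N]add0n; apply: eq_big => m; first exact: dual_grid_period.
  by rewrite dual_grid_period => /vT.
rewrite subrr mul0r subr0 -mulr_natr.
have h2 : 2 * C * mesh_h N ^+ d = 1.
  rewrite card_box_grid /mesh_h -exprMn mulfV ?expr1n //.
  by rewrite pnatr_eq0 -lt0n muln_gt0 N_gt0.
have t2 : (2 * K)%:R * mesh_tau K = 1 :> R.
  by rewrite mulfV // pnatr_eq0 -lt0n muln_gt0 K_gt0.
transitivity (A * (2 * C * mesh_h N ^+ d) * ((2 * K)%:R * mesh_tau K)).
  by rewrite h2 t2 !mulr1.
by ring.
Qed.

End Mean.
End Scheme.

(** * Dot product *)

Section DotProduct.
Context {R : realType} {d : nat}.
Implicit Types (u w : 'rV[R]_d).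

Lemma dotpBl u u' w : dotp (u - u') w = dotp u w - dotp u' w.
Proof. by rewrite /dotp -sumrB; apply: eq_bigr => j _; rewrite !mxE mulrBl. Qed.

Lemma dotpDl u u' w : dotp (u + u') w = dotp u w + dotp u' w.
Proof. by rewrite /dotp -big_split; apply: eq_bigr => j _; rewrite !mxE mulrDl. Qed.

Lemma dotpZl a u w : dotp (a *: u) w = a * dotp u w.
Proof. by rewrite /dotp mulr_sumr; apply: eq_bigr => j _; rewrite !mxE mulrA. Qed.

Lemma dotpZr a u w : dotp u (a *: w) = a * dotp u w.
Proof. by rewrite /dotp mulr_sumr; apply: eq_bigr => j _; rewrite !mxE mulrCA. Qed.

Lemma dotp_sumr (I : finType) u (F : I -> 'rV[R]_d) :
  dotp u (\sum_i F i) = \sum_i dotp u (F i).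
Proof.
rewrite /dotp exchange_big; apply: eq_bigr => j _.
by rewrite summxE mulr_sumr.
Qed.

Lemma ler_coord_norm u j : `|u 0 j| <= `|u|.
Proof.
rewrite [leRHS]mx_normrE.
exact: (le_bigmax 0 (fun ij => `|u ij.1 ij.2|) (0, j)).
Qed.

Lemma ler_norm_dotp u w : `|dotp u w| <= d%:R * `|u| * `|w|.
Proof.
apply: le_trans (ler_norm_sum _ _ _) _.
rewrite -mulrA -[d in d%:R]card_ord mulr_natl -sumr_const.
by apply: ler_sum => j _; rewrite normrM ler_pM // ler_coord_norm.
Qed.

Lemma ler_norm_dotp_dir_idx (o : @dir d) w :
  `|dotp (map_mx intr (dir_idx o)) w| <= `|w|.
Proof.
suff -> : `|dotp (map_mx intr (dir_idx o)) w| = `|w 0 o.2| by exact: ler_coord_norm.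
rewrite /dotp (bigD1 o.2) //= big1 ?addr0 => [|j /negPf jo].
  by case: o => -[] j; rewrite /dir_idx !mxE !eqxx ?mul1r //= rmorphN mulN1r normrN.
by case: o jo => -[] i /= jo; rewrite /dir_idx /= !mxE jo /= ?oppr0 mul0r.
Qed.

End DotProduct.

(** * Expected cost of a control *)

Section RandomWalk.
Context {R : realType} {d : nat} (d_gt0 : (0 < d)%N).
Context (N K : nat) (N_gt0 : (0 < N)%N) (K_gt0 : (0 < K)%N).
Context (l : nat) (n : 'rV[int]_d).
Implicit Types (s : {ffun 'I_l.+1 -> @dir d}) (xi : nat -> 'rV[int]_d -> 'rV[R]_d).

Lemma walk_last s : walk n s l.+1 = n.
Proof. by rewrite /walk big1 ?addr0 // => i; rewrite leqNgt ltn_ord. Qed.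

Lemma walk_jump s (k : 'I_l.+1) : walk n s k = walk n s k.+1 + dir_idx (s k).
Proof.
rewrite /walk (bigD1 k) //= -addrA [_ + dir_idx _]addrC; congr (_ + (_ + _)).
by apply: eq_bigl => i; rewrite ltn_neqAle andbC eq_sym.
Qed.

Lemma walk_dual_grid s k : dual_grid l.+1 n -> (k <= l.+1)%N ->
  dual_grid k (walk n s k).
Proof.
move=> ln kl; rewrite -(subKn kl); move: (l.+1 - k)%N (leq_subr k l.+1) => j.
elim: j => [|j IHj] jl; first by rewrite subn0 walk_last.
have lt_l : (l.+1 - j.+1 < l.+1)%N by rewrite ltn_subrL.
rewrite (walk_jump s (Ordinal lt_l)) /= dual_gridS -subSn // subSS.
exact/IHj/ltnW.
Qed.

(** The bound [(d * lambda)^-1] on the controls is precisely what makes the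
    drift part of a jump probability at most its uniform part [(2 * d)^-1]. *)
Lemma jump_proba_ge0_le1 xi k m o : admissible N K xi -> dual_grid k.+1 m ->
  0 <= jump_proba N K xi k m o <= 1.
Proof.
move=> adm km; have lam := mesh_lambda_gt0 (R := R) N_gt0 K_gt0.
have d0 : 0 < d%:R :> R by rewrite ltr0n.
have := le_trans (ler_norm_dotp_dir_idx o _) (adm k.+1 m isT km).
set x := dotp _ _ => xle.
have {xle} : `|mesh_lambda N K / 2 * x| <= (2 * d)%:R^-1.
  rewrite normrM gtr0_norm; last by rewrite divr_gt0.
  apply: le_trans (ler_wpM2l _ xle) _; first by rewrite ltW // divr_gt0.
  rewrite natrM le_eqVlt; apply/orP; left; apply/eqP; field.
  by rewrite !gt_eqF.
have : (2 * d)%:R^-1 <= 2^-1 :> R.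
  by rewrite lef_pV2 ?posrE ?ltr0n ?muln_gt0 // ler_nat leq_pmulr.
by rewrite /jump_proba -/x ler_norml; lra.
Qed.

Lemma walk_proba_ge0_le1 xi s : admissible N K xi -> dual_grid l.+1 n ->
  0 <= walk_proba N K n xi s <= 1.
Proof.
move=> adm ln.
have itv (k : 'I_l.+1) : 0 <= jump_proba N K xi k (walk n s k.+1) (s k) <= 1.
  by apply: jump_proba_ge0_le1 => //; exact: walk_dual_grid.
by rewrite prodr_ile1 ?andbT ?prodr_ge0 // => k _; case/andP: (itv k).
Qed.

(** The displacement [\sum_k tau * xi] accumulated along a path: this is the
    vector that [c] is paired with in the cost. *)
Definition drift xi s : 'rV[R]_d :=
  \sum_(k < l.+1) mesh_tau K *: xi k.+1 (walk n s k.+1).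

Lemma ler_norm_drift xi s : admissible N K xi -> dual_grid l.+1 n ->
  `|drift xi s| <= time K l.+1 * (d%:R * mesh_lambda N K)^-1.
Proof.
move=> adm ln; apply: le_trans (ler_norm_sum _ _ _) _.
rewrite /time mulrAC mulr_natr -[X in _ *+ X]card_ord -sumr_const.
apply: ler_sum => k _; have tau0 := mesh_tau_gt0 (R := R) K_gt0.
by rewrite normrZ gtr0_norm // ler_pM2l // adm //; exact: walk_dual_grid.
Qed.

Context (L : 'rV[R]_d -> R -> 'rV[R]_d -> R).

Definition running_cost xi s : R :=
  \sum_(k < l.+1) L (pos N (walk n s k.+1)) (time K k)
    (xi k.+1 (walk n s k.+1)) * mesh_tau K.

Lemma expected_costE xi c (u : 'rV[int]_d -> R) :
  expected_cost L N K l n xi c u =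
  \sum_(s : {ffun 'I_l.+1 -> dir}) walk_proba N K n xi s *
    (running_cost xi s - dotp c (drift xi s) + u (walk n s 0)).
Proof.
apply: eq_bigr => s _; congr (_ * (_ + _)).
rewrite /drift dotp_sumr -sumrB; apply: eq_bigr => k _.
by rewrite /lagrangian_c dotpZr mulrBl [mesh_tau K * _]mulrC.
Qed.

Lemma expected_cost_affine xi c c' t (u : 'rV[int]_d -> R) :
  expected_cost L N K l n xi (t *: c + (1 - t) *: c') u =
  t * expected_cost L N K l n xi c u
  + (1 - t) * expected_cost L N K l n xi c' u.
Proof.
rewrite !expected_costE !mulr_sumr -big_split; apply: eq_bigr => s _ /=.
by rewrite dotpDl !dotpZl; ring.
Qed.

(** Without a lower bound the infimum in the stochastic representation would be
    a default value.  The bound comes from the Lagrangian being bounded below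
    (superlinearity with slope 0) and from the boundedness of the controls. *)
Lemma expected_cost_lbound c (u : 'rV[int]_d -> R) :
  lagrangian L -> dual_grid l.+1 n ->
  has_lbound [set expected_cost L N K l n xi c u | xi in admissible N K].
Proof.
move=> hL ln; have [b Lb] := lagr_superlinear hL (lexx 0).
pose B := b * time K l.+1
          - d%:R * `|c| * (time K l.+1 * (d%:R * mesh_lambda N K)^-1).
(* As each path has a probability between 0 and 1, its contribution is at
   least minus the absolute value of any lower bound of its cost. *)
exists (- \sum_(s : {ffun 'I_l.+1 -> dir}) `|B + u (walk n s 0)|).
move=> _ [xi adm <-]; rewrite expected_costE -sumrN; apply: ler_sum => s _.
have /andP[p0 p1] := walk_proba_ge0_le1 s adm ln.
set p := walk_proba _ _ _ _ _ in p0 p1 *.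
have run : b * time K l.+1 <= running_cost xi s.
  rewrite /time mulrA mulr_natr -[X in _ *+ X]card_ord -sumr_const.
  apply: ler_sum => k _; rewrite ler_pM2r ?mesh_tau_gt0 //.
  by rewrite -[b]add0r -{1}(mul0r (enorm (xi k.+1 (walk n s k.+1)))).
have dr : dotp c (drift xi s) <=
    d%:R * `|c| * (time K l.+1 * (d%:R * mesh_lambda N K)^-1).
  apply: le_trans (ler_norm _) (le_trans (ler_norm_dotp _ _) _).
  by rewrite ler_wpM2l ?mulr_ge0 // ler_norm_drift.
have YB : B + u (walk n s 0) <=
    running_cost xi s - dotp c (drift xi s) + u (walk n s 0).
  by rewrite lerD2r lerB.
apply: le_trans (ler_wpM2l p0 YB); set y := B + _.
have := normr_ge0 y; have := ler_norm (- y); rewrite normrN; nra.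
Qed.

End RandomWalk.

(** * Comparison principle and long-time behaviour *)

Section LongTime.
Context {R : realType} {d : nat} (d_gt0 : (0 < d)%N).
Context (L : 'rV[R]_d -> R -> 'rV[R]_d -> R) (hL : lagrangian L).
Context (P : set 'rV[R]_d) (r : R) (r_gt0 : 0 < r).
Context (N K : nat) (N_gt0 : (0 < N)%N) (K_gt0 : (0 < K)%N).
Context (lambda1 : R) (hSA : standing_assumption L N K P r lambda1).
Implicit Types (c : 'rV[R]_d) (m n : 'rV[int]_d) (u w : 'rV[int]_d -> R).

Lemma Xdelta_addcst u a : Xdelta N r u -> Xdelta N r (fun m => u m + a).
Proof.
case=> uP uX; split; first by move=> j m /uP ->.
by move=> m /uX; rewrite (@Dx_addcst _ _ N u _ m m a).
Qed.

Lemma phi_step_le_expected_cost c u l n xi : P c -> Xdelta N r u ->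
  dual_grid l.+1 n -> admissible N K xi ->
  phi_step L N K c u l.+1 n <= expected_cost L N K l n xi c u.
Proof.
move=> Pc uX ln adm; rewrite (sa_representation hSA Pc uX ln).
by apply: ge_inf; [exact: expected_cost_lbound | exists xi].
Qed.

(** The control that is optimal at the intermediate parameter is a competitor at
    both ends, and its cost is affine in the parameter. *)
Lemma phi_step_concave c c' t u k n : P c -> P c' -> 0 <= t <= 1 ->
  P (t *: c + (1 - t) *: c') -> Xdelta N r u -> dual_grid k n ->
  t * phi_step L N K c u k n + (1 - t) * phi_step L N K c' u k n <=
  phi_step L N K (t *: c + (1 - t) *: c') u k n.
Proof.
move=> Pc Pc' /andP[t0 t1] Pt uX; case: k => [|l] ln.
  by rewrite /= le_eqVlt; apply/orP; left; apply/eqP; ring.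
have [adm opt] := sa_minimizer hSA Pt uX.
rewrite (opt _ _ ln) expected_cost_affine lerD // ler_wpM2l ?subr_ge0 //.
  exact: phi_step_le_expected_cost.
exact: phi_step_le_expected_cost.
Qed.

Lemma optimal_control_addcst c u a :
  optimal_control L N K c (fun m => u m + a) = optimal_control L N K c u.
Proof.
apply/funext => -[//|k]; apply/funext => m /=; congr (hamiltonian_p _ _ _ (_ + _)).
by apply: Dx_addcst => o; exact: phi_step_addcst.
Qed.

(** Adding 1 to the datum raises the value by 1 and does not change the optimal
    control, whereas it raises the expected cost by the total mass of the paths:
    this mass is therefore 1. *)
Lemma sum_walk_proba_optimal c u l n : P c -> Xdelta N r u ->
  dual_grid l.+1 n ->
  \sum_(s : {ffun 'I_l.+1 -> dir})
    walk_proba N K n (optimal_control L N K c u) s = 1.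
Proof.
move=> Pc uX ln; have [_ opt] := sa_minimizer hSA Pc uX.
have [_] := sa_minimizer hSA Pc (Xdelta_addcst 1 uX).
move=> /(_ _ _ ln); rewrite phi_step_addcst // (opt _ _ ln).
rewrite optimal_control_addcst !expected_costE => /esym E.
rewrite -(addrK (expected_cost L N K l n (optimal_control L N K c u) c u) 1).
rewrite [X in X - _]addrC expected_costE -E -sumrB; apply: eq_bigr => s _.
by ring.
Qed.

(** The control that is optimal for [(c, u)] is tested in the problem for
    [(c', u')]: the running costs cancel, and what remains is the pairing of
    [c - c'] with the drift, whose speed is at most [(d * lambda)^-1], and the
    difference of the data. *)
Lemma phi_step_compare c c' u u' a k n : P c -> P c' ->
  Xdelta N r u -> Xdelta N r u' -> (forall m, Godd m -> u' m <= u m + a) ->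
  dual_grid k n ->
  phi_step L N K c' u' k n <=
  phi_step L N K c u k n + (time K k * ((mesh_lambda N K)^-1 * `|c - c'|) + a).
Proof.
move=> Pc Pc' uX uX' le_u; case: k => [|l] ln.
  by rewrite /= /time mulr0 mul0r add0r le_u.
have [adm opt] := sa_minimizer hSA Pc uX; have {}opt := opt _ _ ln.
apply: le_trans (phi_step_le_expected_cost Pc' uX' ln adm) _.
rewrite opt !expected_costE; set b := _ + a.
rewrite -[b]mul1r -(sum_walk_proba_optimal Pc uX ln) mulr_suml -big_split.
apply: ler_sum => s _ /=; rewrite -mulrDr; apply: ler_wpM2l.
  by case/andP: (walk_proba_ge0_le1 d_gt0 N_gt0 K_gt0 s adm ln).
have lam0 := mesh_lambda_gt0 (R := R) N_gt0 K_gt0.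
have d0 : 0 < d%:R :> R by rewrite ltr0n.
set D := drift _ _ _ _.
have cD : dotp c D - dotp c' D <=
    time K l.+1 * ((mesh_lambda N K)^-1 * `|c - c'|).
  rewrite -dotpBl; apply: le_trans (ler_norm _) _.
  apply: le_trans (ler_norm_dotp _ _) _.
  apply: le_trans (ler_wpM2l _ (ler_norm_drift K_gt0 s adm ln)) _.
    by rewrite mulr_ge0.
  rewrite le_eqVlt; apply/orP; left; apply/eqP; field.
  by rewrite !gt_eqF.
have := le_u _ (walk_dual_grid s ln (leq0n _)).
by rewrite /b; lra.
Qed.

Lemma Xdelta_bounded u : Xdelta N r u ->
  exists B : R, forall m, Godd m -> `|u m| <= B.
Proof.
case=> uP _.
have [B uB] := periodic_bounded N_gt0 (@periodic_restrict_grid _ _ N 0 _ uP).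
exists B => m m_odd; have := uB m.
by rewrite /restrict_grid dual_gridE m_odd.
Qed.

Definition stationary_level c A : Prop :=
  exists2 u, Xdelta N r u & stationary L N K c A u.

(** A datum that is stationary at level [A] loses exactly [A] per period, so
    [phi_step + time * A] takes finitely many values along it at the node [n];
    the comparison principle transfers the bound to every other datum. *)
Lemma phi_step_growth c A u n : P c -> stationary_level c A -> Xdelta N r u ->
  exists C : R, forall k, dual_grid k n ->
    `|phi_step L N K c u k n + time K k * A| <= C.
Proof.
move=> Pc [u0 u0X st] uX.
have [B0 u0B] := Xdelta_bounded u0X; have [B uB] := Xdelta_bounded uX.
pose C := \sum_(i < 2 * K) `|phi_step L N K c u0 i n + time K i * A|.
exists (B0 + B + C) => k kn.
have near : `|phi_step L N K c u k n - phi_step L N K c u0 k n| <= B0 + B.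
  have le1 m : Godd m -> u m <= u0 m + (B0 + B).
    by move=> mo; have := u0B _ mo; have := uB _ mo; rewrite !ler_norml; lra.
  have le2 m : Godd m -> u0 m <= u m + (B0 + B).
    by move=> mo; have := u0B _ mo; have := uB _ mo; rewrite !ler_norml; lra.
  have := phi_step_compare Pc Pc u0X uX le1 kn.
  have := phi_step_compare Pc Pc uX u0X le2 kn.
  by rewrite subrr normr0 !mulr0 add0r ler_norml; lra.
suff bar : `|phi_step L N K c u0 k n + time K k * A| <= C.
  apply: le_trans (lerD near bar); apply: le_trans (ler_normD _ _).
  by rewrite addrA subrK.
have K2 : (0 < 2 * K)%N by rewrite muln_gt0.
(* The node [n] is fixed and only the time is reduced modulo a period, so that
   [C] is a finite sum. *)
have kE : k = (k %% (2 * K) + k %/ (2 * K) * (2 * K))%N.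
  by rewrite addnC -divn_eq.
have kn' : dual_grid (k %% (2 * K)) n.
  by move: kn; rewrite {1}kE mulnCA dual_grid_period.
rewrite {1 2}kE (phi_step_periods d_gt0 hL K_gt0 _ st kn').
rewrite timeD time_periods // mulrDl addrACA addNr addr0 /C.
by rewrite (bigD1 (Ordinal (ltn_pmod k K2))) //= lerDl sumr_ge0.
Qed.

Lemma solves0_time_average_cvg c A u (v : nat -> 'rV[int]_d -> R) n :
  P c -> stationary_level c A -> Xdelta N r u ->
  starts_from u v -> solves L N K c 0 v ->
  v l.+1 n / time K l.+1
    @[l --> within [set l : nat | dual_grid l.+1 n] \oo] --> - A.
Proof.
move=> Pc lev uX vu sv; have [C le_C] := phi_step_growth n Pc lev uX.
apply/cvgrPdist_le => e e0; rewrite near_withinE; near=> l => /= ln.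
have t0 : 0 < time K l.+1 :> R by rewrite mulr_gt0 ?mesh_tau_gt0 // ltr0n.
rewrite (solves_phi_step d_gt0 K_gt0 sv vu ln) mul0r addr0.
have -> : - A - phi_step L N K c u l.+1 n / time K l.+1 =
    - ((phi_step L N K c u l.+1 n + time K l.+1 * A) / time K l.+1).
  by field; rewrite gt_eqF.
rewrite normrN normrM normfV (gtr0_norm t0) ler_pdivrMr //.
apply: le_trans (le_C _ ln) _.
rewrite -ler_pdivrMl // /time -ler_pdivrMl ?mesh_tau_gt0 //.
apply: le_trans (le_trans (ler_norm _) (ltW (archi_boundP (normr_ge0 _)))) _.
rewrite ler_nat leqW //.
by near: l; exact: nbhs_infty_ge.
Unshelve. all: by end_near.
Qed.

Lemma le0_of_bounded_multiples (x C : R) :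
  (forall j : nat, j%:R * x <= C) -> x <= 0.
Proof.
move=> le_C; rewrite leNgt; apply/negP => x0.
have := le_C (Num.bound `|C / x|); apply/negP.
rewrite -ltNge -ltr_pdivrMr //.
exact: le_lt_trans (ler_norm _) (archi_boundP (normr_ge0 _)).
Qed.

(** Growth rates for different parameters are compared along one and the same
    datum, at one node, and after whole periods, where the time is an integer. *)
Lemma reference_datum : exists2 u, Xdelta N r u &
  exists n, (forall j, dual_grid (j * (2 * K)) n) /\
  forall c A, P c -> stationary_level c A -> exists C : R, forall j,
    `|phi_step L N K c u (j * (2 * K)) n + j%:R * A| <= C.
Proof.
have X0 : Xdelta N r (fun _ : 'rV[int]_d => 0 : R).
  split=> // m _; rewrite (_ : Dx _ _ _ = 0) ?normr0 ?ltW //.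
  by apply/rowP => j; rewrite !mxE subrr mul0r.
exists (fun=> 0) => //.
exists (unit_idx (Ordinal d_gt0)).
have on_grid j : dual_grid (j * (2 * K)) (unit_idx (Ordinal d_gt0)).
  rewrite -[(j * _)%N]add0n mulnCA dual_grid_period.
  exact: Godd_unit_idx.
split=> // c A Pc lev.
have [C le_C] := phi_step_growth (unit_idx (Ordinal d_gt0)) Pc lev X0.
by exists C => j; rewrite -(time_periods K_gt0); exact: le_C.
Qed.

Lemma stationary_level_convex c c' t A A' B :
  P c -> P c' -> 0 <= t <= 1 -> P (t *: c + (1 - t) *: c') ->
  stationary_level c A -> stationary_level c' A' ->
  stationary_level (t *: c + (1 - t) *: c') B ->
  B <= t * A + (1 - t) * A'.
Proof.
move=> Pc Pc' t01 Pt levA levA' levB.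
have [u uX [n [on_grid rate]]] := reference_datum.
have [C le_C] := rate _ _ Pc levA; have [C' le_C'] := rate _ _ Pc' levA'.
have [D le_D] := rate _ _ Pt levB.
rewrite -subr_le0.
apply: (@le0_of_bounded_multiples _ (D + t * C + (1 - t) * C')) => j.
have concave := phi_step_concave Pc Pc' t01 Pt uX (on_grid j).
have := le_C j; have := le_C' j; have := le_D j; rewrite !ler_norml.
move=> /andP[_ hD] /andP[hC' _] /andP[hC _].
have /andP[t0 t1] := t01; rewrite -subr_ge0 in t1.
by have := ler_wpM2l t0 hC; have := ler_wpM2l t1 hC'; lra.
Qed.

(** Convexity on a compact convex set would only give local Lipschitz
    continuity in the relative interior.  The bound up to the boundary comes
    from the bound on the controls: moving [c] changes the cost of a path by at
    most [|c - c'| / lambda] per unit of time. *)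
Lemma stationary_level_lipschitz c c' A A' : P c -> P c' ->
  stationary_level c A -> stationary_level c' A' ->
  `|A - A'| <= (mesh_lambda N K)^-1 * `|c - c'|.
Proof.
wlog suff le : c c' A A' /
    P c -> P c' -> stationary_level c A -> stationary_level c' A' ->
    A - A' <= (mesh_lambda N K)^-1 * `|c - c'|.
  move=> Pc Pc' levA levA'; rewrite ler_norml lerNl opprB.
  by apply/andP; split; [rewrite distrC|]; exact: le.
move=> Pc Pc' levA levA'; rewrite -subr_le0.
have [u uX [n [on_grid rate]]] := reference_datum.
have [C le_C] := rate _ _ Pc levA; have [C' le_C'] := rate _ _ Pc' levA'.
apply: (@le0_of_bounded_multiples _ (C + C')) => j.
have le_u m : Godd m -> u m <= u m + 0 by rewrite addr0.
have := phi_step_compare Pc Pc' uX uX le_u (on_grid j).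
rewrite time_periods //.
have := le_C j; have := le_C' j; rewrite !ler_norml.
by move=> /andP[hC' _] /andP[_ hC]; lra.
Qed.

End LongTime.

(** * Properties of the effective Hamiltonian *)

Theorem theorem3p2 (R : realType) (d : nat) (d_gt0 : (0 < d)%N)
  (L : 'rV[R]_d -> R -> 'rV[R]_d -> R) (hL : lagrangian L)
  (P : set 'rV[R]_d) (P_compact : compact P)
  (P_convex : convex_set (P : set (convex_lmodType 'rV[R]_d)))
  (r : R) (r_gt0 : 0 < r)
  (N K : nat) (N_gt0 : (0 < N)%N) (K_gt0 : (0 < K)%N)
  (lambda1 : R) (hSA : standing_assumption L N K P r lambda1)
  (Hbar : 'rV[R]_d -> R)
  (hHbar : forall c, P c -> is_effective_hamiltonian L N K r c (Hbar c)) :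
  [/\
      forall (c : 'rV[R]_d) (A : R) (v0 : 'rV[int]_d -> R),
        P c -> Xdelta N r v0 ->
        (exists2 v, solution L N K r c A v0 v & time_periodic K v) <->
        A = Hbar c /\ stationary L N K c (Hbar c) v0,
      forall (c : 'rV[R]_d) (v0 : 'rV[int]_d -> R)
          (vbar : nat -> 'rV[int]_d -> R),
        P c -> solution L N K r c (Hbar c) v0 vbar -> time_periodic K vbar ->
        Hbar c =
          \sum_(k < 2 * K) \sum_(m : 'rV['I_(2 * N)]_d | grid k (box_idx m))
            hamiltonian L (pos N (box_idx m)) (time K k)
              (c + Dx N (vbar k) (box_idx m))
            * (2 * mesh_h N ^+ d * mesh_tau K),
      forall (c : 'rV[R]_d) (v0 : 'rV[int]_d -> R)
          (v : nat -> 'rV[int]_d -> R),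
        P c -> Xdelta N r v0 -> starts_from v0 v -> solves L N K c 0 v ->
        forall n : 'rV[int]_d,
          v l.+1 n / time K l.+1
            @[l --> within [set l : nat | dual_grid l.+1 n] \oo] --> - Hbar c
    &
      convex_function (P : set (convex_lmodType 'rV[R]_d)) Hbar /\
      [lipschitz (Hbar c : R^o) | c in P]].
Proof.
have level c : P c -> stationary_level L r N K c (Hbar c).
  by case/hHbar.
split=> [c A v0 Pc v0X|c v0 v Pc [vP _ _ sv] vT|c v0 v Pc v0X v0E sv n|].
- split=> [[v [_ _ v0E sv] vT]|[-> st]].
    have st := time_periodic_stationary d_gt0 K_gt0 sv v0E vT.
    have [_ uniq_A] := hHbar _ Pc.
    have AE : Hbar c = A by apply: uniq_A; exists v0.
    by rewrite AE.
  exists (fun k m => phi_step L N K c v0 k m + Hbar c * time K k).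
    split=> //; last exact: solves_phi_step_addt.
      by move=> k j m km; rewrite phi_step_periodic //; case: v0X.
    by move=> m _; rewrite /time /= !mulr0 addr0.
  exact: time_periodic_phi_step.
- exact: mean_hamiltonian.
- exact: (solves0_time_average_cvg d_gt0 hL N_gt0 K_gt0 hSA n Pc (level c Pc)
    v0X v0E sv).
split.
  move=> t x y /set_mem Px /set_mem Py.
  have t01 : (0 : R) <= t%:num <= 1 by rewrite ge0 le1.
  have Pxy : P (t%:num *: (x : 'rV[R]_d) + (1 - t%:num) *: (y : 'rV[R]_d)).
    by apply/set_mem; apply: (P_convex x y t); exact/mem_set.
  exact: (stationary_level_convex d_gt0 hL r_gt0 N_gt0 K_gt0 hSA Px Py t01 Pxy
    (level _ Px) (level _ Py) (level _ Pxy)).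
exists (mesh_lambda N K)^-1; split; first exact: num_real.
move=> M leM [x y] [/= Px Py].
apply: le_trans (stationary_level_lipschitz d_gt0 hL r_gt0 N_gt0 K_gt0 hSA Px Py
  (level _ Px) (level _ Py)) _.
by rewrite ler_wpM2r // ltW.
Qed.
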